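(* (1) $\mathcal{K}^{\mathsf{TS}}(\overline{K_n})=\{k:k\ge1\}$ for $n\ge2$. (2) $\mathcal{K}^{\mathsf{TS}}(\overline{K_{1,1}})=\{k:k\ge1\}$ and $\mathcal{K}^{\mathsf{TS}}(\overline{K_{1,n}})=\{1,n-1\}$ for $n\ge2$. (3) For $2\le m\le n$: $\mathcal{K}^{\mathsf{TS}}(\overline{K_{m,n}})=\{1,n-1\}$ if $m=n$, and $=\{1\}$ if $m<n$. (4) $\mathcal{K}^{\mathsf{TS}}(\overline{B_1})=\{k:k\ge1\}$ and $\mathcal{K}^{\mathsf{TS}}(\overline{B_p})=\{1,p-1\}$ for $p\ge2$. (5) $\mathcal{K}^{\mathsf{TS}}(\overline{P_n})=\{1\}$ for $n\ge3$. (6) $\mathcal{K}^{\mathsf{TS}}(\overline{C_n})=\{1\}$ for $n\ge4$. (7) $\mathcal{K}^{\mathsf{TS}}(\overline{F_1})=\{k:k\ge1\}$, $\mathcal{K}^{\mathsf{TS}}(\overline{F_2})=\{1\}$, $\mathcal{K}^{\mathsf{TS}}(\overline{F_3})=\{1,2\}$, and $\mathcal{K}^{\mathsf{TS}}(\overline{F_p})=\{1\}$ for $p\ge4$.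
   Context: All graphs are finite, simple, undirected; $\overline{G}$ denotes the complement of $G$. A $k$-clique of a graph $H$ is a set of $k$ pairwise adjacent vertices. For a graph $H$ and integer $k\ge1$, the Token Sliding graph $\mathsf{TS}_k(H)$ has as vertices the $k$-cliques of $H$, and two $k$-cliques $A,B$ are adjacent iff $A\setminus B=\{u\}$, $B\setminus A=\{v\}$ for some vertices $u,v$ with $uv\in E(H)$. For a graph $G$, $\mathcal{K}^{\mathsf{TS}}(G)=\{k\ge1:\ \exists H,\ \mathsf{TS}_k(H)\cong G\}$. $K_n$, $P_n$, $C_n$ denote the complete graph, path, cycle on $n$ vertices; $K_{m,n}$ the complete bipartite graph. The book graph $B_p$ consists of $p$ triangles sharing a common edge; the friendship graph $F_p$ consists of $p$ triangles sharing a common vertex. *)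

(* Defs.v *)
From mathcomp Require Import all_boot.
Set Implicit Arguments. Unset Strict Implicit. Unset Printing Implicit Defensive.

Definition simple_graph (T : finType) (e : rel T) : Prop :=
  symmetric e /\ irreflexive e.

Definition compl (T : finType) (e : rel T) : rel T :=
  fun x y => (x != y) && ~~ e x y.

Definition giso (T1 T2 : finType) (e1 : rel T1) (e2 : rel T2) : Prop :=
  exists f : T1 -> T2, bijective f /\ forall x y, e2 (f x) (f y) = e1 x y.

Definition is_kclique {T : finType} (e : rel T) (k : nat) (A : {set T}) : bool :=
  (#|A| == k) && [forall x in A, forall y in A, (x != y) ==> e x y].

Definition kcliques {T : finType} (e : rel T) (k : nat) : finType :=
  {A : {set T} | is_kclique e k A}.

Definition TS_adj {T : finType} (e : rel T) (k : nat) : rel (kcliques e k) :=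
  fun A B => [exists u, exists v,
    [&& val A :\: val B == [set u], val B :\: val A == [set v] & e u v]].

Arguments TS_adj {T} e k.
Arguments kcliques {T} e k.

Definition KTS (U : finType) (g : rel U) (k : nat) : Prop :=
  1 <= k /\ exists (T : finType) (e : rel T),
    simple_graph e /\ giso (TS_adj e k) g.

Definition Kn (n : nat) : rel 'I_n := fun x y => x != y.

Definition Kmn (m n : nat) : rel ('I_m + 'I_n)%type :=
  fun x y => match x, y with
             | inl _, inr _ | inr _, inl _ => true
             | _, _ => false end.

(* book graph B_p on 'I_(p+2): spine {0,1}, page vertices 2..p+1 *)
Definition Book (p : nat) : rel 'I_(p + 2) :=
  fun x y => (x != y) && ((val x < 2) || (val y < 2)).

Definition Path (n : nat) : rel 'I_n :=
  fun x y => ((val x).+1 == val y) || ((val y).+1 == val x).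

Definition Cycle (n : nat) : rel 'I_n :=
  fun x y => ((val x).+1 %% n == val y) || ((val y).+1 %% n == val x).

(* friendship graph F_p on 'I_(2p+1): center 0, triangles {0, 2i+1, 2i+2} *)
Definition Friend (p : nat) : rel 'I_(p.*2.+1) :=
  fun x y => (x != y) &&
    [|| val x == 0, val y == 0 | (val x).-1./2 == (val y).-1./2].

Arguments Kn n : clear implicits.
Arguments Kmn m n : clear implicits.
Arguments Book p : clear implicits.
Arguments Path n : clear implicits.
Arguments Cycle n : clear implicits.
Arguments Friend p : clear implicits.

(* Main.v *)
(** If k-cliques A, B are adjacent in TS_k(H), then W = A ∪ B is a (k+1)-clique whose k-subsets
    form a (k+1)-clique of TS_k(H), and a k-clique outside W is adjacent to at most two of them.
    For TS_k(H) isomorphic to the complement of G this says: every pair of distinct nonadjacent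
    vertices of G lies in a unique block, that is, an independent set of size k+1 in which every
    outside vertex has at least k-1 neighbours.  For k >= 2 this excludes everything but the listed
    cases; C_7 with k = 2 is the only one where uniqueness of the block is needed.  The positive
    cases are TS_1(H) = H and disjoint unions of Johnson graphs TS_k(K_n). *)

Require Import Defs.
From mathcomp Require Import all_boot zify.
Set Implicit Arguments. Unset Strict Implicit. Unset Printing Implicit Defensive.

(** * Token sliding graphs in terms of vertex sets *)

Lemma is_kcliqueP (T : finType) (e : rel T) k (A : {set T}) :
  reflect (#|A| = k /\ {in A &, forall x y, x != y -> e x y}) (is_kclique e k A).
Proof.
apply: (iffP andP) => [[/eqP cA /forall_inP eA]|[cA eA]]; split => //.
- by move=> x y xA yA xy; move/forall_inP: (eA x xA) => /(_ y yA); rewrite xy.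
- exact/eqP.
- by apply/forall_inP => x xA; apply/forall_inP => y yA; apply/implyP; apply: eA.
Qed.

(** This form does not mention the swapped vertices. By inclusion-exclusion the union has k + 1
    vertices exactly when both differences are singletons. *)
Lemma TS_adjE (T : finType) (e : rel T) k (A B : kcliques e k) : simple_graph e ->
  TS_adj e k A B = is_kclique e k.+1 (val A :|: val B).
Proof.
case=> sym_e irr_e.
have /is_kcliqueP[cA eA] := valP A; have /is_kcliqueP[cB eB] := valP B.
apply/existsP/is_kcliqueP => [[u /existsP[v /and3P[/eqP Au /eqP Bv uv]]]|[cAB eAB]].
  split.
    by have := cardsUI (val A) (val B); have := cardsID (val B) (val A); rewrite Au cards1; lia.
  have inA x : x \in val A -> x != u -> x \in val B.
    move=> xA; apply: contraNT => xB.
    by rewrite -in_set1 -Au inE xA xB.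
  have inB x : x \in val B -> x != v -> x \in val A.
    move=> xB; apply: contraNT => xA.
    by rewrite -in_set1 -Bv inE xA xB.
  have one x y : x \in val A -> y \in val B -> x != y -> e x y.
    move=> xA yB xy; have [xu|xu] := eqVneq x u; last exact: (eB _ _ (inA _ xA xu) yB).
    have [yv|yv] := eqVneq y v; first by rewrite xu yv.
    exact: (eA _ _ xA (inB _ yB yv)).
  move=> x y; rewrite !inE => /orP[xA|xB] /orP[yA|yB] xy.
  - exact: eA.
  - exact: one.
  - by rewrite sym_e; apply: one; rewrite // eq_sym.
  - exact: eB.
have /eqP/cards1P[u Au] : #|val A :\: val B| = 1.
  by have := cardsUI (val A) (val B); have := cardsID (val B) (val A); lia.
have /eqP/cards1P[v Bv] : #|val B :\: val A| = 1.
  by have := cardsUI (val A) (val B); have := cardsID (val A) (val B); rewrite (setIC (val B)); lia.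
exists u; apply/existsP; exists v; rewrite Au Bv !eqxx /=.
have /setDP[uA uB] : u \in val A :\: val B by rewrite Au set11.
have /setDP[vB vA] : v \in val B :\: val A by rewrite Bv set11.
apply: eAB; rewrite ?inE ?uA ?vB ?orbT //.
by apply: contraNneq uB => ->.
Qed.

(* [h] is the isomorphism onto the token sliding graph, seen as a map into vertex sets. *)
Definition TS_repr (U T : finType) (c : rel U) (e : rel T) k (h : U -> {set T}) : Prop :=
  [/\ simple_graph e, injective h,
      forall B, is_kclique e k B <-> exists x, h x = B
    & forall x y, c x y = is_kclique e k.+1 (h x :|: h y)].

(** This trades the subtype of k-cliques for plain vertex sets; in the converse the isomorphism
    sends a clique to the chosen [h]-preimage. *)
Lemma KTSP (U : finType) (c : rel U) k :
  KTS c k <-> 1 <= k /\ exists (T : finType) (e : rel T) h, TS_repr c e k h.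
Proof.
split=> -[k_gt0 [T [e]]].
  move=> [simple_e [f [[g fK gK] fE]]]; split=> //.
  exists T, e, (val \o g); split=> //.
  - exact: inj_comp val_inj (can_inj gK).
  - move=> B; split=> [kB|[x <-]]; last exact: valP.
    by exists (f (Sub B kB)); rewrite /= fK.
  - by move=> x y; rewrite -{1}(gK x) -{1}(gK y) fE TS_adjE.
move=> [h [simple_e h_inj hP hE]]; split=> //; exists T, e; split=> //.
have hk x : is_kclique e k (h x) by apply/hP; exists x.
pose g x : kcliques e k := Sub (h x) (hk x).
have g_inj : injective g by move=> x y /(congr1 val)/h_inj.
have g_onto B : exists x, g x == B.
  by case: B => B kB; have [x hx] := (hP B).1 kB; exists x; apply/eqP/val_inj.
exists (fun B => xchoose (g_onto B)); split.
  exists g => [B|x]; first exact/eqP/(xchooseP (g_onto B)).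
  exact/g_inj/eqP/(xchooseP (g_onto (g x))).
have hx B : h (xchoose (g_onto B)) = val B.
  by rewrite -[LHS]/(val (g _)) (eqP (xchooseP (g_onto B))).
by move=> A B; rewrite hE TS_adjE // !hx.
Qed.

Lemma KTS_iso (U V : finType) (c : rel U) (d : rel V) k :
  giso c d -> KTS c k -> KTS d k.
Proof.
move=> [f [f_bij fE]] [k_gt0 [T [e [simple_e [g [g_bij gE]]]]]]; split=> //.
exists T, e; split=> //; exists (f \o g); split; first exact: bij_comp.
by move=> x y; rewrite /= fE gE.
Qed.

(** * Blocks: the necessary condition *)

(** The successor in the last bound replaces a truncated k - 1. *)
Definition TS_block (U : finType) (g : rel U) k (Q : {set U}) : Prop :=
  [/\ #|Q| = k.+1, {in Q &, forall x y, ~~ g x y}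
    & forall z, z \notin Q -> k <= #|[set y in Q | g z y]|.+1].

(* The blocks are the sets of k-cliques contained in a given (k+1)-clique W.  A k-clique that
   is not contained in W and meets it in a (k-1)-set D is adjacent only to k-cliques between D and W. *)
Lemma KTS_blocks (U : finType) (g : rel U) k : symmetric g -> irreflexive g ->
  KTS (compl g) k ->
  exists F : {set {set U}},
    [/\ forall Q, Q \in F -> TS_block g k Q,
        forall x y, x != y -> ~~ g x y -> exists2 Q, Q \in F & x \in Q /\ y \in Q
      & forall Q R x y, Q \in F -> R \in F -> x != y ->
          x \in Q -> y \in Q -> x \in R -> y \in R -> Q = R].
Proof.
move=> sym_g irr_g /KTSP[k_gt0 [T [e [h [[sym_e irr_e] h_inj hP hE]]]]].
have hk x : #|h x| = k.
  by have /is_kcliqueP[] : is_kclique e k (h x) by apply/hP; exists x.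
pose q (W : {set T}) := [set x | h x \subset W].
(* Two distinct k-subsets of a (k+1)-set fill it. This yields both independence inside a block and
   uniqueness of the block through a pair. *)
have subU (W : {set T}) x y : #|W| = k.+1 -> x != y -> h x \subset W -> h y \subset W -> h x :|: h y = W.
  move=> cW xy xW yW; apply/eqP; rewrite eqEcard subUset xW yW cW /=.
  rewrite -(hk x) ltnNge; apply: contraNN xy => le.
  have/eqP xU : h x == h x :|: h y by rewrite eqEcard subsetUl.
  by apply/eqP/h_inj/eqP; rewrite eq_sym eqEcard !hk leqnn andbT xU subsetUr.
exists [set q W | W in [set W | is_kclique e k.+1 W]]; split.
- move=> Q /imsetP[W]; rewrite inE => kW ->; have /is_kcliqueP[cW eW] := kW.
  have cQ : #|q W| = k.+1.
    rewrite -(card_imset _ h_inj).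
    transitivity #|[set B : {set T} | B \subset W & #|B| == k]|.
      apply: eq_card => B; apply/imsetP/idP => [[x]|].
        by rewrite !inE => xW ->; rewrite xW hk eqxx.
      rewrite inE => /andP[BW /eqP cB].
      have /hP[x hx] : is_kclique e k B.
        by apply/is_kcliqueP; split=> // x y xB yB; apply: eW; apply: (subsetP BW).
      by exists x; rewrite // inE hx.
    by rewrite cards_draws cW binSn.
  split=> //.
  + move=> x y; rewrite !inE => xW yW.
    have [<-|xy] := eqVneq x y; first by rewrite irr_g.
    by have := hE x y; rewrite (subU W) // kW /compl xy /= => ->.
  + move=> z; rewrite inE => zW; set N := [set y in q W | g z y].
    pose D := h z :&: W.
    have lt_zW : #|D| < k.
      rewrite ltnNge; apply: contraNN zW => le; apply/setIidPl/eqP.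
      by rewrite eqEcard subsetIl hk.
    (* Such a y is adjacent to z in the token graph, so [h z] and [h y] share k - 1 vertices; since
       D has fewer than k, they share exactly D. *)
    have nbr y : y \in q W :\: N -> D \subset h y /\ k <= #|D|.+1.
      rewrite !inE => /andP[ngy yW]; rewrite yW /= in ngy.
      have zy : z != y by apply: contraNneq zW => ->.
      have : compl g z y by rewrite /compl zy.
      rewrite hE => /is_kcliqueP[cU _].
      have cI := cardsUI (h z) (h y); rewrite cU !hk in cI.
      have sub : h z :&: h y \subset D by rewrite setIS.
      have /eqP <- : h z :&: h y == D by rewrite eqEcard sub; lia.
      by rewrite subsetIr; split=> //; lia.
    have cN : #|q W| = #|N| + #|q W :\: N|.
      by rewrite -(cardsID N (q W)) (setIidPr _) //; apply/subsetP => y; rewrite inE => /andP[].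
    suff : #|q W :\: N| <= 2 by lia.
    have [->|[y0 y0N]] := set_0Vmem (q W :\: N); first by rewrite cards0.
    have [_ leD] := nbr _ y0N.
    have cWD : #|W :\: D| = 2.
      have := cardsID D W; rewrite (setIidPr _) ?subsetIr // cW; lia.
    (* Each such [h y] is W minus one vertex outside D, and only two vertices of W lie outside D. *)
    rewrite -cWD -(card_imset _ h_inj).
    apply: leq_trans (leq_imset_card (fun w => W :\ w) _).
    apply/subset_leq_card/subsetP => B /imsetP[y yN ->].
    have [Dy _] := nbr _ yN; move: yN; rewrite !inE => /andP[_ yW].
    have /eqP/cards1P[w Ww] : #|W :\: h y| = 1.
      by have := cardsID (h y) W; rewrite (setIidPr yW) hk cW; lia.
    apply/imsetP; exists w.
      have /setDP[wW wy] : w \in W :\: h y by rewrite Ww set11.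
      by rewrite inE wW andbT; apply: contra wy => /(subsetP Dy).
    by rewrite -Ww setDDr setDv set0U (setIidPr yW).
- move=> x y xy ngxy; have : compl g x y by rewrite /compl xy.
  rewrite hE => kW; exists (q (h x :|: h y)); first by apply: imset_f; rewrite inE.
  by rewrite !inE subsetUl subsetUr.
- move=> Q R x y /imsetP[W]; rewrite inE => /is_kcliqueP[cW _] -> /imsetP[X].
  rewrite inE => /is_kcliqueP[cX _] -> xy; rewrite !inE => xW yW xX yX.
  by rewrite -(subU W x y) // (subU X x y).
Qed.

Lemma block_third (U : finType) (g : rel U) k (Q : {set U}) x y :
  TS_block g k Q -> 1 < k -> x != y -> x \in Q -> y \in Q ->
  exists2 w, w \in Q & [/\ x != w, y != w, ~~ g x w & ~~ g y w].
Proof.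
move=> [cQ indep _] k_gt1 xy xQ yQ.
have /card_gt0P[w] : 0 < #|Q :\ x :\ y|.
  by have := cardsD1 x Q; have := cardsD1 y (Q :\ x); rewrite !inE xQ yQ eq_sym xy cQ /=; lia.
by rewrite !inE => /and3P[wy wx wQ]; exists w => //; rewrite 2!(eq_sym _ w) wx wy !indep.
Qed.

(** For k = 2 a block is a triple and k - 1 = 1, so the triple is independent and dominating. *)
Lemma block2P (U : finType) (g : rel U) (Q : {set U}) x y :
  TS_block g 2 Q -> x != y -> x \in Q -> y \in Q ->
  exists w, [/\ x != w, y != w, ~~ g x w, ~~ g y w
    & forall z, [|| z == x, z == y, z == w, g z x, g z y | g z w]].
Proof.
move=> [cQ indep dom] xy xQ yQ.
have /eqP/cards1P[w Qw] : #|Q :\ x :\ y| = 1.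
  by have := cardsD1 x Q; have := cardsD1 y (Q :\ x); rewrite !inE xQ yQ eq_sym xy cQ /=; lia.
have : w \in Q :\ x :\ y by rewrite Qw set11.
rewrite !inE => /and3P[wy wx wQ].
exists w; split; rewrite 1?eq_sym ?indep // => z.
have QE u : u \in Q -> [|| u == x, u == y | u == w].
  move=> uQ; have := in_set1 u w; rewrite -Qw !inE uQ andbT => <-.
  by case: (u == x); case: (u == y).
have [/QE|zQ] := boolP (z \in Q); first by case/or3P => ->; rewrite ?orbT.
have : 0 < #|[set y in Q | g z y]| by have := dom z zQ; lia.
by case/card_gt0P => u; rewrite inE => /andP[/QE/or3P[]/eqP-> ->]; rewrite ?orbT.
Qed.

Lemma block_two_nbrs (U : finType) (g : rel U) k (Q : {set U}) z :
  TS_block g k Q -> 2 < k -> z \notin Q ->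
  exists u v, [/\ u \in Q, v \in Q, u != v, g z u & g z v].
Proof.
move=> [_ _ dom] k_gt2 zQ.
have /card_gt1P[u [v []]] : 1 < #|[set y in Q | g z y]| by have := dom z zQ; lia.
by rewrite !inE => /andP[uQ zu] /andP[vQ zv] uv; exists u, v.
Qed.

(** The block through x and y is the whole class of x: an outside vertex nonadjacent to x would be
    nonadjacent to the entire block, yet it needs k - 1 >= 1 neighbours there. *)
Lemma KTS_trans_nonadj (U : finType) (g : rel U) k x y :
  symmetric g -> irreflexive g -> KTS (compl g) k -> 1 < k ->
  (forall u v w, ~~ g u v -> ~~ g v w -> ~~ g u w) ->
  x != y -> ~~ g x y -> #|[set z | ~~ g x z]| = k.+1.
Proof.
move=> sym_g irr_g kG k_gt1 tr xy ngxy.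
have [F [Fblock Fcover _]] := KTS_blocks sym_g irr_g kG.
have [Q /Fblock[cQ indep dom] [xQ yQ]] := Fcover x y xy ngxy.
rewrite -cQ; apply: eq_card => z; rewrite inE.
apply/idP/idP => [ngxz|/(indep x)->//].
apply: contraTT k_gt1 => /dom; rewrite -leqNgt => /leq_trans; apply.
rewrite ltnS leqn0 cards_eq0; apply/eqP/setP => u; rewrite !inE.
have [uQ|//] := boolP (u \in Q).
by apply/negbTE/(tr z x u); [rewrite sym_g | apply: indep].
Qed.

(** * Realizations *)

Lemma compl_simple (U : finType) (g : rel U) : symmetric g -> simple_graph (compl g).
Proof. by move=> sym_g; split=> [x y|x]; rewrite /compl ?eqxx // eq_sym sym_g. Qed.

Lemma KTS1 (U : finType) (c : rel U) : simple_graph c -> KTS c 1.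
Proof.
move=> simple_c; have [sym_c irr_c] := simple_c.
apply/KTSP; split=> //; exists U, c, set1; split=> //; first exact: set1_inj.
  move=> B; split=> [/is_kcliqueP[/eqP/cards1P[x ->]] _|[x <-]]; first by exists x.
  by apply/is_kcliqueP; rewrite cards1; split=> // u v /set1P-> /set1P->; rewrite eqxx.
move=> x y; apply/idP/is_kcliqueP => [cxy|[]]; rewrite cards2.
  have xy : x != y by apply: contraTneq cxy => ->; rewrite irr_c.
  split; first by rewrite xy.
  move=> u v /set2P[]-> /set2P[]->; rewrite ?eqxx //.
  by rewrite sym_c.
case: eqVneq => // xy _ /(_ x y); rewrite xy !inE !eqxx !orbT => cxy.
exact: cxy.
Qed.

(** The witness is a disjoint union of copies of K_k, one per vertex: each copy is a single
    k-clique, and no (k+1)-clique exists. *)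
Lemma KTS_edgeless (U : finType) (c : rel U) k :
  (forall x y, c x y = false) -> 0 < k -> KTS c k.
Proof.
case: k => // k c0 _; apply/KTSP; split=> //.
pose e (p q : U * 'I_k.+1) := (p.1 == q.1) && (p.2 != q.2).
have cX (x : U) : #|setX [set x] [set: 'I_k.+1]| = k.+1.
  by rewrite cardsX cards1 cardsT card_ord mul1n.
have sub n B p : is_kclique e n B -> p \in B -> B \subset setX [set p.1] setT.
  move=> /is_kcliqueP[_ eB] pB; apply/subsetP => q qB; rewrite !inE andbT.
  have [->//|qp] := eqVneq q p.
  by case/andP: (eB q p qB pB qp).
exists _, e, (fun x => setX [set x] setT); split.
- split=> [p q|p]; first by rewrite /e eq_sym (eq_sym p.2).
  by rewrite /e !eqxx.
- move=> x y /setP/(_ (x, ord0)); rewrite !inE /= eqxx /=.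
  by move/esym/andP => [/eqP].
- move=> B; split=> [kB|[x <-]].
    have /is_kcliqueP[cB eB] := kB.
    have /card_gt0P[p pB] : 0 < #|B| by rewrite cB.
    by exists p.1; apply/eqP; rewrite eq_sym eqEcard (sub _ _ _ kB pB) cX cB /=.
  apply/is_kcliqueP; split=> // -[u i] [v j]; rewrite !inE !andbT /=.
  move=> /eqP-> /eqP->; rewrite /e /= eqxx /=.
  by apply: contraNneq => ->.
- move=> x y; rewrite c0; apply/esym/negbTE/negP => kU.
  have := subset_leq_card (sub _ _ (x, ord0) kU _).
  rewrite cX !inE /= eqxx => /(_ isT); case/is_kcliqueP: kU => -> _.
  by rewrite ltnn.
Qed.

Definition dsum (U V : finType) (c : rel U) (d : rel V) : rel (U + V)%type :=
  fun x y => match x, y with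
             | inl u, inl v => c u v
             | inr u, inr v => d u v
             | _, _ => false end.

Lemma is_kclique_imset (T T' : finType) (f : T -> T') (e : rel T) (e' : rel T') k (A : {set T}) :
  injective f -> (forall x y, e' (f x) (f y) = e x y) ->
  is_kclique e' k (f @: A) = is_kclique e k A.
Proof.
move=> f_inj fE; apply/is_kcliqueP/is_kcliqueP; rewrite card_imset // => -[cA eA]; split=> //.
  by move=> x y xA yA xy; rewrite -fE; apply: eA; rewrite ?imset_f // inj_eq.
by move=> _ _ /imsetP[x xA ->] /imsetP[y yA ->]; rewrite inj_eq // fE; apply: eA.
Qed.

(** Since k >= 1, every k-clique of the disjoint union of the two witnesses is nonempty and lies on
    exactly one side. *)
Lemma KTS_dsum (U V : finType) (c : rel U) (d : rel V) k :
  KTS c k -> KTS d k -> KTS (dsum c d) k.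
Proof.
move=> /KTSP[k_gt0 [T [e [h [[sym_e irr_e] h_inj hP hE]]]]].
move=> /KTSP[_ [T' [e' [h' [[sym_e' irr_e'] h'_inj h'P h'E]]]]].
have inl_inj : injective (@inl T T') by move=> ? ? [].
have inr_inj : injective (@inr T T') by move=> ? ? [].
have hk x : is_kclique e k (h x) by apply/hP; exists x.
have h'k x : is_kclique e' k (h' x) by apply/h'P; exists x.
have h0 x : exists t, t \in h x.
  by apply/card_gt0P; have /is_kcliqueP[->] := hk x.
have h'0 x : exists t, t \in h' x.
  by apply/card_gt0P; have /is_kcliqueP[->] := h'k x.
pose H (x : U + V) := match x with inl u => inl @: h u | inr v => (@inr T T') @: h' v end.
have kl n (A : {set T}) : is_kclique (dsum e e') n (inl @: A) = is_kclique e n A.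
  exact: is_kclique_imset.
have kr n (A : {set T'}) : is_kclique (dsum e e') n (inr @: A) = is_kclique e' n A.
  exact: is_kclique_imset.
have mixed n B t t' : is_kclique (dsum e e') n B -> inl t \in B -> inr t' \in B -> False.
  by move=> /is_kcliqueP[_ eB] /eB/[apply]/(_ isT).
apply/KTSP; split=> //; exists _, (dsum e e'), H; split.
- by split=> [[x|x] [y|y]|[x|x]] /=.
- move=> [x|x] [y|y] /= HE.
  + by congr inl; apply/h_inj/(imset_inj inl_inj).
  + have [t /(imset_f (@inl T T'))] := h0 x; rewrite HE => /imsetP[] //.
  + have [t /(imset_f (@inl T T'))] := h0 y; rewrite -HE => /imsetP[] //.
  + by congr inr; apply/h'_inj/(imset_inj inr_inj).
- move=> B; split=> [kB|[[x|x] <-] /=]; last 2 first.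
  + by rewrite kl.
  + by rewrite kr.
  have /is_kcliqueP[cB _] := kB.
  have /card_gt0P[[t|t] tB] : 0 < #|B| by rewrite cB.
  + have BE : B = inl @: [set u | inl u \in B].
      apply/setP => -[u|u].
        by rewrite mem_imset // inE.
      by apply/idP/imsetP => [/(mixed _ _ _ _ kB tB)//|[]].
    move: kB; rewrite {1}BE kl => /hP[x hx].
    by exists (inl x); rewrite /= hx -BE.
  + have BE : B = inr @: [set u | inr u \in B].
      apply/setP => -[u|u]; last first.
        by rewrite mem_imset // inE.
      by apply/idP/imsetP => [uB|[]//]; case: (mixed _ _ _ _ kB uB tB).
    move: kB; rewrite {1}BE kr => /h'P[x hx].
    by exists (inr x); rewrite /= hx -BE.
- move=> [x|x] [y|y] /=; rewrite -?imsetU ?kl ?kr //; apply/esym/negP => kB.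
  + have [[t tx] [t' ty]] := (h0 x, h'0 y).
    by apply: (mixed _ _ t t' kB); rewrite inE ?(imset_f inl tx) ?(imset_f inr ty) ?orbT.
  + have [[t tx] [t' ty]] := (h0 y, h'0 x).
    by apply: (mixed _ _ t t' kB); rewrite inE ?(imset_f inl tx) ?(imset_f inr ty) ?orbT.
Qed.

(** The witness is the complete graph on T, where every k-set is a clique; the cardinality
    hypothesis makes [h] reach all of them, so [c] is a Johnson graph. *)
Lemma KTS_johnson (U T : finType) (c : rel U) k (h : U -> {set T}) :
  0 < k -> injective h -> (forall x, #|h x| = k) -> #|U| = 'C(#|T|, k) ->
  (forall x y, c x y = (#|h x :|: h y| == k.+1)) -> KTS c k.
Proof.
move=> k_gt0 h_inj hk cU hE; apply/KTSP; split=> //.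
pose e (x y : T) := x != y.
have kE n B : is_kclique e n B = (#|B| == n).
  by apply/is_kcliqueP/eqP => [[]//|cB]; split.
exists T, e, h; split=> [||B|x y] //.
- by split=> [x y|x]; rewrite /e ?eqxx // eq_sym.
- rewrite kE; split=> [cB|[x <-]]; last by rewrite hk.
  have : B \in [set h x | x in U].
    suff -> : [set h x | x in U] = [set B : {set T} | #|B| == k] by rewrite inE.
    apply/eqP; rewrite eqEcard card_draws card_imset // cU leqnn andbT.
    by apply/subsetP => _ /imsetP[x _ ->]; rewrite inE hk.
  by case/imsetP=> x _ ->; exists x.
- by rewrite kE hE.
Qed.

(** K_n is the Johnson graph J(n, n-1): a vertex stands for the complement of its singleton. *)
Lemma KTS_Kn n : 1 < n -> KTS (Kn n) (n - 1).
Proof.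
move=> n_gt1; apply: (@KTS_johnson _ 'I_n _ _ (fun x => [set~ x])).
- lia.
- by move=> x y /setC_inj/set1_inj.
- by move=> x; rewrite cardsC1 card_ord; lia.
- by rewrite !card_ord bin_sub ?bin1 //; lia.
- move=> x y; rewrite /Kn -setCI.
  have [<-|xy] := eqVneq x y.
    by rewrite setIid cardsC1 card_ord; apply/esym/negbTE; lia.
  have -> : [set x] :&: [set y] = set0.
    by apply/setP => z; rewrite !inE; case: eqVneq => // ->; rewrite (negbTE xy).
  by rewrite setC0 cardsT card_ord subn1 prednK ?eqxx // ltnW.
Qed.

(** This is K_{2,2,2} = J(4,2), with antipodal pairs {0,1}, {2,3}, {4,5}. *)
Definition octahedron : rel 'I_6 := fun x y => (val x)./2 != (val y)./2.

(** The edges are grouped into the three perfect matchings of K_4, so that antipodal vertices of the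
    octahedron name disjoint edges. *)
Definition K4_edge (i : nat) : seq nat :=
  nth [::] [:: [:: 0; 1]; [:: 2; 3]; [:: 0; 2]; [:: 1; 3]; [:: 0; 3]; [:: 1; 2]] i.

Lemma card_ord4 (P : pred nat) : #|[set t : 'I_4 | P t]| = P 0 + P 1 + P 2 + P 3.
Proof.
rewrite -sum1dep_card big_mkcond !big_ord_recl big_ord0 /=.
by do 4 case: (P _).
Qed.

Lemma KTS_octahedron : KTS octahedron 2.
Proof.
apply: (@KTS_johnson _ 'I_4 _ _ (fun x : 'I_6 => [set t : 'I_4 | val t \in K4_edge x])) => //.
- move=> x y /setP hE; apply/val_inj.
  have {hE} E (t : 'I_4) : (val t \in K4_edge x) = (val t \in K4_edge y).
    by have := hE t; rewrite !inE.
  (* Membership of 0, 1 and 2 already separates the six edges. *)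
  move: (E ord0) (E (@Ordinal 4 1 isT)) (E (@Ordinal 4 2 isT)).
  by case: x y E => [[|[|[|[|[|[|//]]]]]] lx] [[|[|[|[|[|[|//]]]]]] ly].
- move=> x; rewrite (card_ord4 (mem (K4_edge x))).
  by case: x => [[|[|[|[|[|[|//]]]]]] lx].
- by rewrite !card_ord.
- move=> x y.
  have -> : [set t : 'I_4 | val t \in K4_edge x] :|: [set t : 'I_4 | val t \in K4_edge y]
      = [set t : 'I_4 | val t \in K4_edge x ++ K4_edge y].
    by apply/setP => t; rewrite !inE mem_cat.
  rewrite (card_ord4 (mem (K4_edge x ++ K4_edge y))).
  by case: x y => [[|[|[|[|[|[|//]]]]]] lx] [[|[|[|[|[|[|//]]]]]] ly].
Qed.

Lemma KTS_compl_Kmn m n k : KTS (Kn m) k -> KTS (Kn n) k -> KTS (compl (Kmn m n)) k.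
Proof.
move=> km kn; apply: KTS_iso (KTS_dsum km kn).
exists id; split; first by exists id.
by move=> [x|x] [y|y]; rewrite /compl /= ?andbT.
Qed.

(** The complement consists of two isolated spine vertices and a K_p on the pages. *)
Lemma KTS_compl_Book p k : KTS (Kn p) k -> 0 < k -> KTS (compl (Book p)) k.
Proof.
move=> kp k_gt0.
have k2 : KTS (compl (Kn 2)) k.
  by apply: KTS_edgeless => // x y; rewrite /compl /Kn; case: eqVneq.
apply: KTS_iso (KTS_dsum k2 kp).
exists (fun x => cast_ord (addnC 2 p) (unsplit x)); split.
  apply: inj_card_bij; last by rewrite card_sum !card_ord addnC.
  by move=> x y /cast_ord_inj/(can_inj unsplitK).
move=> [x|x] [y|y]; rewrite /compl /Book /Kn -!val_eqE /= -?val_eqE /=.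
all: by case: x y => [x lx] [y ly] /=; lia.
Qed.

(** The complement is the isolated centre plus an octahedron on the three outer edges. *)
Lemma KTS_compl_Friend3 : KTS (compl (Friend 3)) 2.
Proof.
have k1 : KTS (compl (Kn 1)) 2.
  by apply: KTS_edgeless => // x y; rewrite /compl /Kn; case: eqVneq.
apply: KTS_iso (KTS_dsum k1 KTS_octahedron).
exists (fun x => unsplit x); split.
  apply: inj_card_bij; last by rewrite card_sum !card_ord.
  exact: (can_inj unsplitK).
move=> [x|x] [y|y]; rewrite /compl /Friend /Kn /octahedron -!val_eqE /= -?val_eqE /=.
all: by case: x y => [x lx] [y ly] /=; lia.
Qed.

(** * Exclusions for complete bipartite and book graphs *)

Lemma Kmn_sym m n : symmetric (Kmn m n).
Proof. by move=> [x|x] [y|y]. Qed.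

Lemma Kmn_irr m n : irreflexive (Kmn m n).
Proof. by move=> [x|x]. Qed.

Lemma Book_sym p : symmetric (Book p).
Proof. by move=> x y; rewrite /Book eq_sym orbC. Qed.

Lemma Book_irr p : irreflexive (Book p).
Proof. by move=> x; rewrite /Book eqxx. Qed.

Lemma Path_sym n : symmetric (Path n).
Proof. by move=> x y; rewrite /Path orbC. Qed.

Lemma Path_irr n : irreflexive (Path n).
Proof. by move=> x; rewrite /Path; lia. Qed.

Lemma Cycle_sym n : symmetric (Cycle n).
Proof. by move=> x y; rewrite /Cycle orbC. Qed.

Lemma Cycle_irr n : 1 < n -> irreflexive (Cycle n).
Proof.
move=> n_gt1 x; rewrite /Cycle orbb /=; have lt_xn := ltn_ord x.
have [eq_xn|neq_xn] := eqVneq x.+1 n; first by rewrite eq_xn modnn; lia.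
by rewrite modn_small; lia.
Qed.

Lemma Friend_sym p : symmetric (Friend p).
Proof. by move=> x y; rewrite /Friend -!val_eqE /=; lia. Qed.

Lemma Friend_irr p : irreflexive (Friend p).
Proof. by move=> x; rewrite /Friend eqxx. Qed.

Lemma Kmn_nonadj_trans m n u v w : ~~ Kmn m n u v -> ~~ Kmn m n v w -> ~~ Kmn m n u w.
Proof. by case: u v w => [u|u] [v|v] [w|w]. Qed.

(** A side with at least two vertices is a full nonadjacency class, hence has k + 1 elements. For
    books the class is the set of pages. *)
Lemma KTS_compl_Kmn_size m n k : 1 < n -> 1 < k -> KTS (compl (Kmn m n)) k -> n = k.+1.
Proof.
move=> n_gt1 k_gt1 kG.
pose x : 'I_n := Ordinal (ltnW n_gt1); pose y : 'I_n := Ordinal n_gt1.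
rewrite -(KTS_trans_nonadj (@Kmn_sym m n) (@Kmn_irr m n) kG k_gt1 (@Kmn_nonadj_trans m n)
  (x := inr x) (y := inr y)) //.
rewrite -[LHS]card_ord -cardsT -(card_imset _ (@inr_inj 'I_m 'I_n)).
apply: eq_card => z; rewrite inE; apply/imsetP/idP => [[w _ ->]//|].
by case: z => // w _; exists w.
Qed.

Lemma KTS_compl_Book_size p k : 1 < p -> 1 < k -> KTS (compl (Book p)) k -> p = k.+1.
Proof.
move=> p_gt1 k_gt1 kG.
have BookN u v : ~~ Book p u v = (u == v) || (1 < u) && (1 < v).
  by rewrite /Book negb_and negbK negb_or -!leqNgt.
have tr u v w : ~~ Book p u v -> ~~ Book p v w -> ~~ Book p u w.
  by rewrite !BookN -!val_eqE /=; lia.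
pose f (i : 'I_p) := cast_ord (addnC 2 p) (rshift 2 i).
have f_inj : injective f by move=> i j /cast_ord_inj/rshift_inj.
pose x := f (Ordinal (ltnW p_gt1)); pose y := f (Ordinal p_gt1).
have xy : x != y by rewrite (inj_eq f_inj).
have ngxy : ~~ Book p x y by rewrite BookN.
rewrite -(KTS_trans_nonadj (@Book_sym p) (@Book_irr p) kG k_gt1 tr xy ngxy).
rewrite -[LHS]card_ord -cardsT -(card_imset _ f_inj).
apply: eq_card => z; rewrite inE BookN.
apply/imsetP/orP => [[w _ ->]|]; first by right.
case=> [/eqP<-|/andP[_ z_gt1]]; first by exists (Ordinal (ltnW p_gt1)).
have lt_zp : z - 2 < p by have := ltn_ord z; lia.
by exists (Ordinal lt_zp); rewrite //; apply/val_inj => /=; lia.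
Qed.

(** * Consequences of the block through a nonadjacent pair *)

Section NonadjacentPair.

Variables (U : finType) (g : rel U) (k : nat) (x y : U).
Hypotheses (sym_g : symmetric g) (irr_g : irreflexive g).
Hypotheses (kG : KTS (compl g) k) (k_gt1 : 1 < k) (xy : x != y) (ngxy : ~~ g x y).

Lemma KTS_third : exists w, [/\ x != w, y != w, ~~ g x w & ~~ g y w].
Proof.
have [F [Fblock Fcover _]] := KTS_blocks sym_g irr_g kG.
have [Q /Fblock bQ [xQ yQ]] := Fcover x y xy ngxy.
by have [w _] := block_third bQ k_gt1 xy xQ yQ; exists w.
Qed.

Lemma KTS2_dominating_third : k = 2 ->
  exists w, [/\ x != w, y != w, ~~ g x w, ~~ g y w
    & forall z, [|| z == x, z == y, z == w, g z x, g z y | g z w]].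
Proof.
move=> k2; have [F [Fblock Fcover _]] := KTS_blocks sym_g irr_g kG.
have [Q /Fblock bQ [xQ yQ]] := Fcover x y xy ngxy.
by apply: block2P xQ yQ => //; rewrite -k2.
Qed.

(** A neighbour z of x lies outside the independent block through x and y, so it has k - 1 >= 2
    neighbours in it. A z with too few neighbours compatible with y rules out every k >= 3. *)
Lemma KTS_gt2_two_nbrs z : 2 < k -> g z x ->
  exists u v, [/\ u != v, g z u & g z v] /\ [/\ ~~ g u v, ~~ g y u & ~~ g y v].
Proof.
move=> k_gt2 zx; have [F [Fblock Fcover _]] := KTS_blocks sym_g irr_g kG.
have [Q /Fblock bQ [xQ yQ]] := Fcover x y xy ngxy; have [_ indep _] := bQ.
have zQ : z \notin Q by apply/negP => zQ; have := indep z x zQ xQ; rewrite zx.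
have [u [v [uQ vQ uv zu zv]]] := block_two_nbrs bQ k_gt2 zQ.
by exists u, v; split; split=> //; apply: indep.
Qed.

End NonadjacentPair.

(** * Exclusions for paths and cycles *)

Lemma not_KTS_compl_Path n k : 2 < n -> 1 < k -> ~ KTS (compl (Path n)) k.
Proof.
move=> n_gt2 k_gt1 kG.
have third := KTS_third (@Path_sym n) (@Path_irr n) kG k_gt1.
have dom := KTS2_dominating_third (@Path_sym n) (@Path_irr n) kG.
have nbrs := KTS_gt2_two_nbrs (@Path_sym n) (@Path_irr n) kG.
pose v i (lt_in : i < n) : 'I_n := Ordinal lt_in.
have [n3|n_neq3] := eqVneq n 3.
  have l0 : 0 < n by lia. have l2 : 2 < n by lia.
  have [] := third (v 0 l0) (v 2 l2); rewrite /Path -?val_eqE //= => w [].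
  by rewrite -!val_eqE /=; have := ltn_ord w; lia.
(* For k >= 3: vertex 0 has the single neighbour 1. *)
have [k2|k_neq2] := eqVneq k 2; last first.
  have l0 : 0 < n by lia. have l1 : 1 < n by lia. have l3 : 3 < n by lia.
  have [||||u [w [[uw zu zw] _]]] := nbrs (v 1 l1) (v 3 l3) _ _ (v 0 l0);
    rewrite /Path -?val_eqE //=; first lia.
  by move: uw zu zw; rewrite /Path -!val_eqE /=; lia.
(* The independent dominating triple a, b, c of the case k = 2, in arithmetic form. *)
have small a b (la : a < n) (lb : b < n) : a.+1 < b ->
    exists c, [/\ c < n, a != c, b != c, (a.+1 != c) && (c.+1 != a) /\ (b.+1 != c) && (c.+1 != b)
    & forall z, z < n -> [|| z == a, z == b, z == c, z.+1 == a, a.+1 == z, z.+1 == b, b.+1 == z,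
       z.+1 == c | c.+1 == z]].
  move=> ab; have [||w []] := dom (v a la) (v b lb) _ _ k2; rewrite /Path -?val_eqE /=; try lia.
  move=> aw bw naw nbw D; exists w; split=> //; first by split; lia.
  by move=> z lz; have := D (v z lz); rewrite /Path -!val_eqE /=; lia.
(* Neither 0 nor 2 dominates 4 or 7, and no single c is within distance 1 of both. *)
have [n_ge8|] := leqP 8 n.
  have [||//|c [? ? ? ? D]] := small 0 2; try lia.
  by have := D 4; have := D 7; lia.
(* For n = 7 the triple 0, 2, 5 is dominating, so the pair 0, 4 is used; it leaves 2 and 6
   undominated. *)
move=> n_le7; have [n7|n_neq7] := eqVneq n 7.
  have [||//|c [? ? ? ? D]] := small 0 4; try lia.
  by have := D 2; have := D 6; lia.
have [n4|n_neq4] := eqVneq n 4.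
  have [||//|c [? ? ? ? D]] := small 0 3; try lia.
(* Here n is 5 or 6, and every other vertex is adjacent to 1 or n - 2. *)
have [|||c [? ? ? ? D]] := small 1 (n - 2); try lia.
Qed.

Lemma Cycle_inner n (z c : 'I_n) : 0 < z -> z.+1 < n ->
  Cycle n z c = (z.+1 == c :> nat) || (c.+1 == z :> nat).
Proof.
move=> z_gt0 z_lt; rewrite /Cycle modn_small //; congr (_ || _).
have [eq_cn|neq_cn] := eqVneq c.+1 n.
  by rewrite eq_cn modnn /=; lia.
by rewrite modn_small //=; have := ltn_ord c; lia.
Qed.

(** In C_4 and C_5 the pair 0, 2, and in C_6 the pair 0, 3, extends to no independent triple. *)
Lemma not_KTS_compl_C4 k : 1 < k -> ~ KTS (compl (Cycle 4)) k.
Proof.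
move=> k_gt1 kG; pose v i (lt_i4 : i < 4) : 'I_4 := Ordinal lt_i4.
have [//|//|w [w0 w2 nw0 nw2]] := KTS_third (@Cycle_sym 4) (@Cycle_irr 4 isT) kG k_gt1
  (x := v 0 isT) (y := v 2 isT).
suff : [|| v 0 isT == w, v 2 isT == w, Cycle 4 (v 0 isT) w | Cycle 4 (v 2 isT) w].
  by rewrite (negbTE w0) (negbTE w2) (negbTE nw0) (negbTE nw2).
by case: w {w0 w2 nw0 nw2} => [[|[|[|[|//]]]] lw].
Qed.

Lemma not_KTS2_compl_C5 : ~ KTS (compl (Cycle 5)) 2.
Proof.
move=> kG; pose v i (lt_i5 : i < 5) : 'I_5 := Ordinal lt_i5.
have [//|//|w [w0 w2 nw0 nw2]] := KTS_third (@Cycle_sym 5) (@Cycle_irr 5 isT) kG isT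
  (x := v 0 isT) (y := v 2 isT).
suff : [|| v 0 isT == w, v 2 isT == w, Cycle 5 (v 0 isT) w | Cycle 5 (v 2 isT) w].
  by rewrite (negbTE w0) (negbTE w2) (negbTE nw0) (negbTE nw2).
by case: w {w0 w2 nw0 nw2} => [[|[|[|[|[|//]]]]] lw].
Qed.

Lemma not_KTS2_compl_C6 : ~ KTS (compl (Cycle 6)) 2.
Proof.
move=> kG; pose v i (lt_i6 : i < 6) : 'I_6 := Ordinal lt_i6.
have [//|//|w [w0 w3 nw0 nw3]] := KTS_third (@Cycle_sym 6) (@Cycle_irr 6 isT) kG isT
  (x := v 0 isT) (y := v 3 isT).
suff : [|| v 0 isT == w, v 3 isT == w, Cycle 6 (v 0 isT) w | Cycle 6 (v 3 isT) w].
  by rewrite (negbTE w0) (negbTE w3) (negbTE nw0) (negbTE nw3).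
by case: w {w0 w3 nw0 nw3} => [[|[|[|[|[|[|//]]]]]] lw].
Qed.

(* The blocks through {0, 3} and {2, 5} can only be {0, 3, 5} and {0, 2, 5}, which share {0, 5}. *)
Lemma not_KTS2_compl_C7 : ~ KTS (compl (Cycle 7)) 2.
Proof.
move=> kG; have [F [Fblock Fcover Funiq]] := KTS_blocks (@Cycle_sym 7) (@Cycle_irr 7 isT) kG.
pose v i (lt_i7 : i < 7) : 'I_7 := Ordinal lt_i7.
have [//|//|Q FQ [Q0 Q3]] := Fcover (v 0 isT) (v 3 isT).
have [//|//|R FR [R2 R5]] := Fcover (v 2 isT) (v 5 isT).
have Q5 : v 5 isT \in Q.
  have [//|w wQ [w0 w3 nw0 nw3]] := block_third (Fblock Q FQ) isT _ Q0 Q3.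
  suff : [|| v 0 isT == w, v 3 isT == w, Cycle 7 (v 0 isT) w, Cycle 7 (v 3 isT) w | w == v 5 isT].
    by rewrite (negbTE w0) (negbTE w3) (negbTE nw0) (negbTE nw3) => /eqP <-.
  by case: w {wQ w0 w3 nw0 nw3} => [[|[|[|[|[|[|[|//]]]]]]] lw].
have R0 : v 0 isT \in R.
  have [//|w wR [w2 w5 nw2 nw5]] := block_third (Fblock R FR) isT _ R2 R5.
  suff : [|| v 2 isT == w, v 5 isT == w, Cycle 7 (v 2 isT) w, Cycle 7 (v 5 isT) w | w == v 0 isT].
    by rewrite (negbTE w2) (negbTE w5) (negbTE nw2) (negbTE nw5) => /eqP <-.
  by case: w {wR w2 w5 nw2 nw5} => [[|[|[|[|[|[|[|//]]]]]]] lw].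
have QR : Q = R by apply: (Funiq Q R (v 0 isT) (v 5 isT)).
have [_ indep _] := Fblock Q FQ.
(* The common block would contain the adjacent vertices 2 and 3. *)
by have := indep (v 2 isT) (v 3 isT); rewrite {1}QR => /(_ R2 Q3).
Qed.

Lemma not_KTS_compl_Cycle n k : 3 < n -> 1 < k -> ~ KTS (compl (Cycle n)) k.
Proof.
move=> n_gt3 k_gt1 kG; have n_gt1 : 1 < n := ltnW (ltnW n_gt3).
have [n4|n_neq4] := eqVneq n 4; first by subst n; apply: not_KTS_compl_C4 kG.
have dom := KTS2_dominating_third (@Cycle_sym n) (Cycle_irr n_gt1) kG.
have nbrs := KTS_gt2_two_nbrs (@Cycle_sym n) (Cycle_irr n_gt1) kG.
pose v i (lt_in : i < n) : 'I_n := Ordinal lt_in.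
have l0 : 0 < n by lia.
have [k2|k_neq2] := eqVneq k 2; last first.
  have l1 : 1 < n by lia. have l2 : 2 < n by lia. have l3 : 3 < n by lia.
  have l4 : 4 < n by lia.
  (* Vertex 1 has neighbours 0 and 2, but 2 is adjacent to 3, so only 0 can lie in the block of 0
     and 3. *)
  have ng03 : ~~ Cycle n (v 0 l0) (v 3 l3) by rewrite Cycle_sym Cycle_inner.
  have g10 : Cycle n (v 1 l1) (v 0 l0) by rewrite Cycle_inner.
  have [//||u [w [[uw zu zw] [_ nyu nyw]]]] := nbrs (v 0 l0) (v 3 l3) _ ng03 (v 1 l1) _ g10.
    lia.
  have only0 t : Cycle n (v 1 l1) t -> ~~ Cycle n (v 3 l3) t -> t = v 0 l0.
    by rewrite !Cycle_inner //= => t1 t3; apply/val_inj => /=; lia.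
  by case/eqP: uw; rewrite (only0 u) // (only0 w).
subst k.
have [n5|n_neq5] := eqVneq n 5; first by subst n; apply: not_KTS2_compl_C5 kG.
have [n6|n_neq6] := eqVneq n 6; first by subst n; apply: not_KTS2_compl_C6 kG.
have [n7|n_neq7] := eqVneq n 7; first by subst n; apply: not_KTS2_compl_C7 kG.
(* The pair 0, b leaves z1 and z2 undominated, and they are too far apart for one w. The choice b =
   2 fails for n = 8, where 0, 2, 5 is dominating. *)
pose b := if n == 8 then 4 else 2; pose z1 := if n == 8 then 2 else 4.
pose z2 := n - 2.
have lb : b < n by rewrite /b; case: ifP; lia.
have lz1 : z1 < n by rewrite /z1; case: ifP; lia.
have lz2 : z2 < n by lia.
have ng0b : ~~ Cycle n (v 0 l0) (v b lb).
  by rewrite Cycle_sym Cycle_inner /= /b; case: ifP; lia.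
have b_neq0 : v 0 l0 != v b lb by rewrite -val_eqE /= /b; case: ifP.
have [w [_ _ _ _ D]] := dom (v 0 l0) (v b lb) b_neq0 ng0b erefl.
have near z (lz : z < n) : 1 < z -> z.+1 < n -> (z.+1 < b) || (b.+1 < z) ->
    (z <= w.+1) && (w <= z.+1).
  move=> z_gt1 z_lt zb; have := D (v z lz).
  by rewrite !Cycle_inner -?val_eqE //=; try lia.
have : (z1 <= w.+1) && (w <= z1.+1) by apply: near; rewrite // /z1 /b; case: ifP; lia.
have : (z2 <= w.+1) && (w <= z2.+1) by apply: near; rewrite // /z2 /b; try case: ifP; lia.
by rewrite /z1 /z2; case: eqP; lia.
Qed.

(** * Exclusions for friendship graphs *)

Lemma KTS_compl_Friend_small p k : 1 < p -> 1 < k -> KTS (compl (Friend p)) k ->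
  p = 3 /\ k = 2.
Proof.
move=> p_gt1 k_gt1 kG.
have dom := KTS2_dominating_third (@Friend_sym p) (@Friend_irr p) kG.
have nbrs := KTS_gt2_two_nbrs (@Friend_sym p) (@Friend_irr p) kG.
pose v i (lt_i : i < p.*2.+1) : 'I_(p.*2.+1) := Ordinal lt_i.
have l1 : 1 < p.*2.+1 by lia. have l2 : 2 < p.*2.+1 by lia. have l3 : 3 < p.*2.+1 by lia.
have [k2|k_neq2] := eqVneq k 2; last first.
  (* Vertex 2 has neighbours 0 and 1, but 0 is adjacent to 3, so only 1 can lie in the block of 1
     and 3. *)
  have [||||u [w [[uw zu zw] [nuw nxu nxw]]]] := nbrs (v 1 l1) (v 3 l3) _ _ (v 2 l2);
    rewrite /Friend -?val_eqE //=; first lia.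
  by move: uw zu zw nuw nxu nxw; rewrite /Friend -!val_eqE /=; lia.
split=> //.
(* The third vertex w must be an outer vertex of a third triangle, so p > 2; it cannot dominate both
   5 and 7, so p < 4. *)
have [||w []] := dom (v 1 l1) (v 3 l3) _ _ k2; rewrite /Friend -?val_eqE //=.
move=> xw yw nxw nyw D; have [p2|p_neq2] := eqVneq p 2.
  by have := ltn_ord w; lia.
have [//|p_neq3] := eqVneq p 3.
have l5 : 5 < p.*2.+1 by lia. have l7 : 7 < p.*2.+1 by lia.
by move: (D (v 5 l5)) (D (v 7 l7)); rewrite /Friend -!val_eqE /=; lia.
Qed.

(** * Assembling the cases *)

Lemma KTS_iff_eq1 (U : finType) (g : rel U) k : symmetric g ->
  (1 < k -> ~ KTS (compl g) k) -> KTS (compl g) k <-> k = 1.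
Proof.
move=> sym_g no; split=> [kG|->]; last exact/KTS1/compl_simple.
case: (ltngtP k 1) => // [k0|/no//].
by case: kG; rewrite leqNgt k0.
Qed.

Lemma KTS_iff_1_or (U : finType) (g : rel U) k n : symmetric g ->
  (1 < k -> KTS (compl g) k -> k = n - 1) -> (1 < n -> KTS (compl g) (n - 1)) ->
  1 < n -> KTS (compl g) k <-> k = 1 \/ k = n - 1.
Proof.
move=> sym_g only ex n_gt1; split=> [kG|[->|->]]; last exact: ex.
  case: (ltngtP k 1) => [k0|k_gt1|]; [|by right; apply: only|by left].
  by case: kG; rewrite leqNgt k0.
exact/KTS1/compl_simple.
Qed.

Lemma KTS_edgeless_iff (U : finType) (c : rel U) k :
  (forall x y, c x y = false) -> KTS c k <-> 1 <= k.
Proof. by move=> c0; split=> [[]//|]; apply: KTS_edgeless. Qed.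

Theorem theorem3p7 :
  (* (1) *)
  (forall n, 2 <= n -> forall k, KTS (compl (Kn n)) k <-> 1 <= k) /\
  (* (2) *)
  (forall k, KTS (compl (Kmn 1 1)) k <-> 1 <= k) /\
  (forall n, 2 <= n -> forall k, KTS (compl (Kmn 1 n)) k <-> (k = 1 \/ k = n - 1)) /\
  (* (3) *)
  (forall m n, 2 <= m -> m <= n -> forall k,
      KTS (compl (Kmn m n)) k <-> (if m == n then k = 1 \/ k = n - 1 else k = 1)) /\
  (* (4) *)
  (forall k, KTS (compl (Book 1)) k <-> 1 <= k) /\
  (forall p, 2 <= p -> forall k, KTS (compl (Book p)) k <-> (k = 1 \/ k = p - 1)) /\
  (* (5) *)
  (forall n, 3 <= n -> forall k, KTS (compl (Path n)) k <-> k = 1) /\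
  (* (6) *)
  (forall n, 4 <= n -> forall k, KTS (compl (Cycle n)) k <-> k = 1) /\
  (* (7) *)
  (forall k, KTS (compl (Friend 1)) k <-> 1 <= k) /\
  (forall k, KTS (compl (Friend 2)) k <-> k = 1) /\
  (forall k, KTS (compl (Friend 3)) k <-> (k = 1 \/ k = 2)) /\
  (forall p, 4 <= p -> forall k, KTS (compl (Friend p)) k <-> k = 1).
Proof.
do ![apply: conj].
- by move=> n _ k; apply: KTS_edgeless_iff => x y; rewrite /compl negbK andNb.
- by move=> k; apply: KTS_edgeless_iff => -[x|x] [y|y]; rewrite /compl //= !ord1 eqxx.
- move=> n n_gt1 k; apply: KTS_iff_1_or => // [|k_gt1 /(KTS_compl_Kmn_size n_gt1 k_gt1)|_].
  + exact: Kmn_sym.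
  + lia.
  + apply: KTS_compl_Kmn; last exact: KTS_Kn.
    (* K_1 is edgeless, so it is realized for every k >= 1. *)
    by apply: KTS_edgeless; [move=> x y; rewrite /Kn !ord1 | lia].
- move=> m n m_gt1 le_mn k.
  have n_gt1 := leq_trans m_gt1 le_mn.
  case: eqVneq => [eq_mn|neq_mn].
    apply: KTS_iff_1_or => // [|k_gt1 /(KTS_compl_Kmn_size n_gt1 k_gt1)|_].
    * exact: Kmn_sym.
    * lia.
    * by rewrite eq_mn; apply: KTS_compl_Kmn; apply: KTS_Kn.
  apply: KTS_iff_eq1 => [|k_gt1 kG]; first exact: Kmn_sym.
  have := KTS_compl_Kmn_size n_gt1 k_gt1 kG.
  (* Swapping the sides gives m = k + 1 as well, against m <> n. *)
  have kG' : KTS (compl (Kmn n m)) k.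
    apply: KTS_iso kG; exists (fun x => match x with inl u => inr u | inr v => inl v end).
    split; last by move=> [x|x] [y|y].
    by exists (fun x => match x with inl u => inr u | inr v => inl v end) => -[].
  have := KTS_compl_Kmn_size m_gt1 k_gt1 kG'; lia.
(* B_1 is a triangle, as is F_1 below, so its complement is edgeless. *)
- move=> k; apply: KTS_edgeless_iff => x y; rewrite /compl /Book -val_eqE /=.
  by have := ltn_ord x; have := ltn_ord y; lia.
- move=> p p_gt1 k; apply: KTS_iff_1_or => // [|k_gt1 /(KTS_compl_Book_size p_gt1 k_gt1)|_].
  + exact: Book_sym.
  + lia.
  + by apply: KTS_compl_Book; [exact: KTS_Kn | lia].
- move=> n n_gt2 k; apply: KTS_iff_eq1; first exact: Path_sym.
  exact: not_KTS_compl_Path.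
- move=> n n_gt3 k; apply: KTS_iff_eq1; first exact: Cycle_sym.
  exact: not_KTS_compl_Cycle.
- move=> k; apply: KTS_edgeless_iff => x y; rewrite /compl /Friend -val_eqE /=.
  by have := ltn_ord x; have := ltn_ord y; lia.
- move=> k; apply: KTS_iff_eq1 => [|k_gt1 kG]; first exact: Friend_sym.
  by have [] := KTS_compl_Friend_small (isT : 1 < 2) k_gt1 kG.
- move=> k; apply: (@KTS_iff_1_or _ _ _ 3) => // [|k_gt1|_].
  + exact: Friend_sym.
  + by case/(KTS_compl_Friend_small (isT : 1 < 3) k_gt1).
  + exact: KTS_compl_Friend3.
- move=> p p_gt3 k; apply: KTS_iff_eq1 => [|k_gt1 kG]; first exact: Friend_sym.
  by have [] := KTS_compl_Friend_small (ltnW (ltnW p_gt3)) k_gt1 kG; lia.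
Qed.
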